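(* Let $\alpha$ be an infinite almost periodic word over the alphabet $\{0,1,2,3\}$ containing at least one non-zero letter. Then $\mathcal{G}^\alpha$ is a minimal hereditary class of graphs of unbounded clique-width: $\mathcal{G}^\alpha$ has unbounded clique-width, and every proper hereditary subclass of $\mathcal{G}^\alpha$ has bounded clique-width.
   Context: A factor of a word is a contiguous subword. An infinite word $\alpha$ is almost periodic if for each factor $\beta$ of $\alpha$ there is a constant $\mathcal{L}(\beta)$ such that every factor of $\alpha$ of length at least $\mathcal{L}(\beta)$ contains $\beta$ as a factor. For an infinite word $\alpha=\alpha_1\alpha_2\cdots$ over $\{0,1,2,3\}$, the infinite graph $\mathcal{P}^\alpha$ has vertex set $\{v_{i,j}: i,j\in\mathbb{N}\}$ ($i$ is the row, $j$ the column; $C_j=\{v_{i,j}:i\in\mathbb{N}\}$). The only edges are between consecutive columns $C_j$ and $C_{j+1}$, determined by $\alpha_j$: if $\alpha_j=0$, $v_{i,j}v_{k,j+1}$ is an edge iff $i=k$; if $\alpha_j=1$, iff $i\neq k$; if $\alpha_j=2$, iff $i\le k$; if $\alpha_j=3$, iff $i\ge k$. $\mathcal{G}^\alpha$ denotes the class of all finite graphs isomorphic to induced subgraphs of $\mathcal{P}^\alpha$; it is hereditary (closed under induced subgraphs). Clique-width is the usual graph parameter (minimum number of labels needed to build the graph with vertex creation, disjoint union, joining all vertices of two distinct labels, and relabelling). *)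

(* Defs.v *)
From mathcomp Require Import all_boot.
From mathcomp Require Import boolp.

Set Implicit Arguments.
Unset Strict Implicit.
Unset Printing Implicit Defensive.

(* Letters and columns are numbered from 0: [alpha j] is the (j+1)-st letter. *)
Definition word4 := nat -> 'I_4.

Definition factor (A : eqType) (w : seq A) (alpha : nat -> A) : Prop :=
  exists i : nat, w = mkseq (fun n => alpha (i + n)) (size w).

Definition almost_periodic (A : eqType) (alpha : nat -> A) : Prop :=
  forall beta : seq A, factor beta alpha ->
  exists L : nat, forall gamma : seq A,
    factor gamma alpha -> L <= size gamma -> infix beta gamma.

Record fgraph := FGraph {
  vertex :> finType;
  adj : rel vertex;
  adj_sym : symmetric adj;
  adj_irr : irreflexive adj
}.

Definition embedding (U V : Type) (eU : rel U) (eV : rel V) (f : U -> V) : Prop :=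
  injective f /\ forall x y, eV (f x) (f y) = eU x y.

Definition induced_in (V : Type) (eV : rel V) (G : fgraph) : Prop :=
  exists f : G -> V, embedding (@adj G) eV f.

Definition isomorphic (G H : fgraph) : Prop :=
  exists f : G -> H, bijective f /\ forall x y, adj (f x) (f y) = adj x y.

Definition graph_class := fgraph -> Prop.

(* Since embeddings need not be inclusions, this includes closure under
   isomorphism. *)
Definition hereditary (C : graph_class) : Prop :=
  forall G H : fgraph, C G -> induced_in (@adj G) H -> C H.

Definition column_link (a : 'I_4) (i k : nat) : bool :=
  match val a with
  | 0 => i == k
  | 1 => i != k
  | 2 => i <= k
  | _ => i >= k
  end.

(* A vertex v_{i,j} is the pair (i, j): row first, then column. *)
Definition Padj (alpha : word4) : rel (nat * nat) := fun u v =>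
  ((v.2 == u.2.+1) && column_link (alpha u.2) u.1 v.1)
  || ((u.2 == v.2.+1) && column_link (alpha v.2) v.1 u.1).

Definition Gclass (alpha : word4) : graph_class := induced_in (Padj alpha).

Inductive cw_expr (k : nat) : Type :=
| CwVertex of 'I_k
| CwUnion of cw_expr k & cw_expr k
| CwJoin (a b : 'I_k) of a != b & cw_expr k
| CwRelabel (a b : 'I_k) of cw_expr k.

Record lgraph (k : nat) := LGraph {
  lgraph_graph :> fgraph;
  label : lgraph_graph -> 'I_k
}.

Section Operations.
Variable k : nat.

Lemma one_sym : symmetric (fun _ _ : unit => false). Proof. by []. Qed.
Lemma one_irr : irreflexive (fun _ _ : unit => false). Proof. by []. Qed.
Definition lg_vertex (a : 'I_k) : lgraph k :=
  @LGraph k (FGraph one_sym one_irr) (fun _ => a).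

Definition union_adj (G H : fgraph) : rel (G + H) := fun u v =>
  match u, v with
  | inl x, inl y => adj x y
  | inr x, inr y => adj x y
  | _, _ => false
  end.
Lemma union_sym G H : symmetric (@union_adj G H).
Proof. by case=> x [y|y] //=; rewrite adj_sym. Qed.
Lemma union_irr G H : irreflexive (@union_adj G H).
Proof. by case=> x /=; rewrite adj_irr. Qed.
Definition lg_union (G H : lgraph k) : lgraph k :=
  @LGraph k (FGraph (@union_sym G H) (@union_irr G H))
    (fun u => match u with inl x => label x | inr y => label y end).

Definition join_adj (a b : 'I_k) (G : lgraph k) : rel G := fun x y =>
  [|| adj x y, (label x == a) && (label y == b)
    | (label x == b) && (label y == a)].
Lemma join_sym a b G : symmetric (@join_adj a b G).
Proof.
move=> x y; rewrite /join_adj adj_sym; congr (_ || _).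
by rewrite orbC andbC [(label y == b) && _]andbC.
Qed.
Lemma join_irr a b G : a != b -> irreflexive (@join_adj a b G).
Proof.
move=> ab x; rewrite /join_adj adj_irr /=.
by case: eqP => [->|_]; rewrite ?(negPf ab) ?andbF.
Qed.
Definition lg_join a b (ab : a != b) (G : lgraph k) : lgraph k :=
  @LGraph k (FGraph (@join_sym a b G) (@join_irr a b G ab)) (@label k G).

Definition lg_relabel (a b : 'I_k) (G : lgraph k) : lgraph k :=
  @LGraph k G (fun x => if label x == a then b else label x).

Fixpoint cw_eval (t : cw_expr k) : lgraph k :=
  match t with
  | CwVertex a => lg_vertex a
  | CwUnion t1 t2 => lg_union (cw_eval t1) (cw_eval t2)
  | CwJoin _ _ ab t1 => lg_join ab (cw_eval t1)
  | CwRelabel a b t1 => lg_relabel a b (cw_eval t1)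
  end.

End Operations.

(* No expression evaluates to the graph without vertices; it is given
   clique-width 0. *)
Definition cw_buildable (G : fgraph) (k : nat) : Prop :=
  #|G| = 0 \/ exists t : cw_expr k, isomorphic (cw_eval t) G.

Section Existence.
Variable G : fgraph.

Let good (l : seq (G * G)) (s : seq G) (t : cw_expr #|G|) :=
  exists f : cw_eval t -> G,
  [/\ injective f, forall x, label x = enum_rank (f x),
      forall v, (v \in s) <-> exists x, f x = v
    & forall x y, adj x y = ((f x, f y) \in l) || ((f y, f x) \in l)].

Lemma cw_edgeless v s : uniq (v :: s) -> exists t, good [::] (v :: s) t.
Proof.
elim: s v => [|w s IH] v /=.
  move=> _; exists (CwVertex (enum_rank v)), (fun _ => v).
  split=> //; first by move=> [] [].
  by move=> u; rewrite inE; split=> [/eqP->|[_ ->]] //; exists tt.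
case/andP=> vs us; have [t [f [fi fl fs fa]]] := IH _ us.
exists (CwUnion (CwVertex (enum_rank v)) t).
exists (fun u => match u with inl _ => v | inr y => f y end); split.
- have nv y : f y <> v.
    by move=> fy; case/negP: vs; apply/fs; exists y.
  move=> [[]|x] [[]|y] //= e; first by case: (nv y).
  + by case: (nv x).
  + by rewrite (fi _ _ e).
- by move=> [x|x] //=.
- move=> u; rewrite in_cons; split.
    case/orP=> [/eqP->|/fs [x <-]]; first by exists (inl tt).
    by exists (inr x).
  case=> [[x|x] <-]; rewrite ?eqxx //.
  by apply/orP; right; apply/fs; exists x.
- by move=> [x|x] [y|y] //=; rewrite fa.
Qed.

Lemma cw_edges s t l : good [::] s t -> all (fun p => p.1 != p.2) l ->
  exists t', good l s t'.
Proof.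
move=> gt; elim: l => [|[a b] l IH] /=; first by exists t.
case/andP=> ab /IH [t' [f [fi fl fs fa]]].
have ab' : enum_rank a != enum_rank b by rewrite (inj_eq enum_rank_inj).
exists (CwJoin ab' t'), f; split=> // x y.
rewrite /= /join_adj fa !fl !(inj_eq enum_rank_inj) !in_cons !xpair_eqE.
rewrite [(f x == b) && _]andbC.
by case: (_ \in l); case: (_ \in l); rewrite ?orbT ?orbF //=.
Qed.

Lemma cw_buildable_ex : exists k, `[< cw_buildable G k >].
Proof.
exists #|G|; apply/asboolP.
case E: (enum G) => [|v s]; first by left; rewrite cardE E.
right; have us : uniq (v :: s) by rewrite -E enum_uniq.
have [t0 gt0] := cw_edgeless us.
have [|t [f [fi fl fs fa]]] :=
    @cw_edges _ _ (enum [pred p : G * G | adj p.1 p.2]) gt0.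
  apply/allP=> -[a b]; rewrite mem_enum inE /= => e.
  by apply: contraTneq e => ->; rewrite adj_irr.
exists t, f; split=> [|x y]; last first.
  by rewrite fa !mem_enum !inE /= [adj (f y) _]adj_sym orbb.
have sur v0 : exists x, f x == v0.
  have /fs [x <-] : v0 \in v :: s by rewrite -E mem_enum.
  by exists x.
exists (fun v0 => xchoose (sur v0)) => x; last exact/eqP/(xchooseP (sur x)).
exact/fi/eqP/(xchooseP (sur (f x))).
Qed.

End Existence.

Definition cliquewidth (G : fgraph) : nat := ex_minn (cw_buildable_ex G).

Definition bounded_cw (C : graph_class) : Prop :=
  exists k : nat, forall G : fgraph, C G -> cliquewidth G <= k.

Definition proper_subclass (D C : graph_class) : Prop :=
  (forall G, D G -> C G) /\ (exists G, C G /\ ~ D G).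

Definition minimal_unbounded_cw (C : graph_class) : Prop :=
  [/\ hereditary C,
      ~ bounded_cw C
    & forall D : graph_class,
        hereditary D -> proper_subclass D C -> bounded_cw D].

(* Main.v *)
From mathcomp Require Import all_boot boolp zify.
Require Import Defs.

Set Implicit Arguments.
Unset Strict Implicit.
Unset Printing Implicit Defensive.

(** Unboundedness: an expression with [c] labels for a large grid has a
    subexpression whose vertex set [U] is balanced and has at most [c]
    neighbourhoods outside [U].  Between two consecutive columns at most [2c] rows
    can change sides, so some row lies inside [U] and another one outside.  Every
    nonzero letter creates an edge between these two rows, and nonzero letters
    occur arbitrarily often at distance at least 3, which gives more than [c]
    neighbourhoods.

    Minimality: a proper hereditary subclass omits a grid on the first [m + 1]
    columns, and the word of this grid recurs with bounded gaps.  In a window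
    carrying that word, call a thread a choice of one vertex per column such that
    the rows are constant at the letters 0 and 1, nondecreasing at 2 and
    nonincreasing at 3.  Threads with pairwise disjoint row ranges form a grid, so
    by interval min-max boundedly many rows meet the range of every thread.
    A set of vertices without threads can be cut between its first and last
    columns so that every column sees the other side uniformly.  Doing this
    between consecutive stabbing rows cuts the graph at every window, with
    boundedly many neighbourhood classes, into pieces of boundedly many columns;
    sweeping the pieces one after the other, each of them row by row, gives a
    linear layout of bounded width. *)

Lemma cliquewidth_le (G : fgraph) k : cw_buildable G k -> cliquewidth G <= k.
Proof. by move=> b; rewrite /cliquewidth; case: ex_minnP => n _; apply; apply/asboolP. Qed.

Lemma cliquewidth_buildable (G : fgraph) : cw_buildable G (cliquewidth G).
Proof. by rewrite /cliquewidth; case: ex_minnP => n /asboolP. Qed.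

(** * Linear layouts *)

Section Layout.
Variables (G : fgraph) (k : nat).

Definition builds (t : cw_expr k) (s : seq G) (f : cw_eval t -> G) : Prop :=
  [/\ injective f, forall v, (v \in s) <-> exists x, f x = v
    & forall x y, adj x y = adj (f x) (f y)].

(** [s'] holds the vertices still to come. A label class must look uniform to them, as later joins
    act on whole classes. *)
Definition respects (t : cw_expr k) (s' : seq G) (f : cw_eval t -> G) : Prop :=
  forall x y, label x = label y -> forall z, z \in s' -> adj (f x) z = adj (f y) z.

(** Joins leave labels alone, so they can be iterated over [bs]; [h] appears because the vertex type
    depends on the expression. *)
Lemma joins_exist (a : 'I_k) (t : cw_expr k) (bs : seq 'I_k) : a \notin bs ->
  exists t' (h : cw_eval t' -> cw_eval t),
  [/\ bijective h, forall x, label (h x) = label x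
    & forall x y, adj x y =
        [|| adj (h x) (h y), (label x == a) && (label y \in bs)
          | (label y == a) && (label x \in bs)]].
Proof.
elim: bs => [_|b bs IH].
  exists t, id; split=> //; first by exists id.
  by move=> x y; rewrite !in_nil !andbF !orbF.
rewrite in_cons negb_or => /andP[ab /IH [t' [h [hb hl ha]]]].
exists (CwJoin ab t'), h; split=> // x y; rewrite /= /join_adj ha !in_cons.
by case: (adj _ _); case: (label x == a); case: (label y == a); case: (label x == b);
  case: (label y == b); case: (label x \in bs); case: (label y \in bs).
Qed.

(* The label [a] is free, so the new vertex can be created with it and joined
   to whole label classes. *)
Lemma layout_add (t : cw_expr k) s v s' f (a : 'I_k) :
  uniq (rcons s v) -> @builds t s f -> @respects t (v :: s') f ->
  (forall x : cw_eval t, label x != a) ->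
  exists t' f', @builds t' (rcons s v) f' /\ @respects t' s' f'.
Proof.
rewrite rcons_uniq => /andP[vs us] [fi fs fa] fr afree.
have nv x : f x <> v by move=> e; case/negP: vs; apply/fs; exists x.
pose bs := [seq b <- enum 'I_k | (b != a) && `[< exists x, label x = b /\ adj (f x) v >]].
have abs : a \notin bs by rewrite mem_filter eqxx.
have bsE x : (label x \in bs) = adj (f x) v.
  rewrite mem_filter mem_enum andbT afree /=; apply/asboolP/idP => [[y [e h]]|h].
    by rewrite -(fr _ _ e) // mem_head.
  by exists x.
pose t0 := CwUnion t (CwVertex a).
have [t' [h [hb hl ha]]] := @joins_exist a t0 bs abs.
pose f0 (u : cw_eval t0) : G := match u with inl x => f x | inr _ => v end.
have f0i : injective f0.
  move=> [x|[]] [y|[]] //= e; first by rewrite (fi _ _ e).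
  - by case: (nv x).
  - by case: (nv y).
have lN x : (@label k (cw_eval t) x == a) = false by apply/negbTE/afree.
exists t', (f0 \o h); split; first split.
- exact: inj_comp f0i (bij_inj hb).
- move=> w; rewrite mem_rcons in_cons; split.
    have [g gh hg] := hb.
    case/orP=> [/eqP->|/fs [x <-]]; first by exists (g (inr tt)); rewrite /= hg.
    by exists (g (inl x)); rewrite /= hg.
  case=> x <- /=; case: (h x) => [y|y] /=; last by rewrite eqxx.
  by apply/orP; right; apply/fs; exists y.
- move=> x y; rewrite ha -!hl /=; case: (h x) => [x'|[]]; case: (h y) => [y'|[]] /=.
  + by rewrite fa !lN !orbF.
  + by rewrite lN eqxx bsE.
  + by rewrite lN eqxx /= bsE orbF adj_sym.
  + by rewrite eqxx (negbTE abs) adj_irr.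
- move=> x y; rewrite -!hl /=; case: (h x) => [x'|[]]; case: (h y) => [y'|[]] //= e z zs.
  + by apply: fr => //; rewrite in_cons zs orbT.
  + by move: (afree x'); rewrite e eqxx.
  + by move: (afree y'); rewrite -e eqxx.
Qed.

End Layout.

(** If all [#|T|.+1] labels are in use, two of them have representatives with the same value of [l],
    by pigeonhole. Relabelling one as the other frees a label. *)
Lemma layout_merge (G : fgraph) (T : finType) (t : cw_expr #|T|.+1) (s s' : seq G)
    (f : cw_eval t -> G) (l : G -> T) :
  builds s f -> respects s' f ->
  (forall x y, x \in s -> y \in s -> l x = l y ->
     forall z, z \in s' -> adj x z = adj y z) ->
  exists t' f' (a : 'I_(#|T|.+1)), [/\ @builds _ _ t' s f', respects s' f' &
    forall x : cw_eval t', label x != a].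
Proof.
move=> fb fr lP; have [fi fs fa] := fb.
have [[a afree]|nfree] := pselect (exists a, forall x : cw_eval t, label x != a).
  by exists t, f, a.
have /choice[rep repP] : forall a, exists x : cw_eval t, label x = a.
  move=> a; apply: contrapT => h; apply: nfree; exists a => x.
  by apply/eqP => e; apply: h; exists x.
have : ~ injective (fun a => l (f (rep a))).
  by move=> /leq_card; rewrite card_ord ltnn.
move=> ninj.
have [a [b [ab e]]] : exists a b, a != b /\ l (f (rep a)) = l (f (rep b)).
  apply: contrapT => h; apply: ninj => a b e; apply: contrapT => /eqP ab.
  by apply: h; exists a, b.
have sab z : z \in s' -> adj (f (rep a)) z = adj (f (rep b)) z.
  by apply: lP => //; apply/fs; eexists.
exists (CwRelabel a b t), f, a; split=> //.
  move=> x y /= exy z zs; move: exy.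
  case: eqP => xa; case: eqP => ya exy.
  - by apply: fr => //; rewrite xa.
  - rewrite (fr x (rep a)) ?repP // sab //; apply: fr => //; by rewrite repP.
  - rewrite (fr y (rep a)) ?repP // sab //; apply: fr => //; by rewrite repP.
  - exact: fr.
by move=> x /=; case: ifP => [_|/negbT //]; rewrite eq_sym.
Qed.

Lemma layout_cliquewidth (G : fgraph) (T : finType) (s : seq G) :
  uniq s -> (forall x, x \in s) ->
  (forall s1 s2, s = s1 ++ s2 -> exists l : G -> T,
     forall x y, x \in s1 -> y \in s1 -> l x = l y ->
       forall z, z \in s2 -> adj x z = adj y z) ->
  cliquewidth G <= #|T|.+1.
Proof.
move=> us sT lP; apply: cliquewidth_le.
case Es: s => [|v0 s0].
  left; apply: eq_card0 => x; by move: (sT x); rewrite Es.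
right.
suff H n : n < size s -> exists t f (a : 'I_(#|T|.+1)),
    [/\ @builds G _ t (take n.+1 s) f, respects (drop n.+1 s) f &
      forall x : cw_eval t, label x != a].
  have [|t [f [_ [[fi fs fa] _ _]]]] := H (size s).-1; first by rewrite Es.
  rewrite prednK in fs; last by rewrite Es.
  rewrite take_size in fs.
  have /choice[g gP] : forall v, exists x, f x = v by move=> v; apply/fs.
  exists t, f; split=> [|x y]; last by rewrite fa.
  by exists g => // x; apply: fi; rewrite gP.
elim: n => [|n IH] ns.
  have := @lP (take 1 s) (drop 1 s); rewrite cat_take_drop => /(_ erefl) [l lp].
  apply: (@layout_merge _ _ (CwVertex ord0) _ _ (fun _ => v0) l) => //.
  split.
  - by move=> [] [].
  - move=> v; rewrite Es /= take0 inE; split=> [/eqP->|[_ ->] //].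
    by exists tt.
  - by move=> [] [] /=; rewrite adj_irr.
have [t [f [a [fb fr fa]]]] := IH (ltnW ns).
have := @lP (take n.+2 s) (drop n.+2 s); rewrite cat_take_drop => /(_ erefl) [l lp].
have [||t' [f' [fb' fr']]] := @layout_add _ _ t _ (nth v0 s n.+1) (drop n.+2 s) f a _ fb _ fa.
- by rewrite -take_nth // take_uniq.
- by rewrite -drop_nth.
rewrite -take_nth // in fb'.
exact: (layout_merge fb' fr' lp).
Qed.

(** * Unbounded clique-width *)

Lemma Padj_sym alpha : symmetric (Padj alpha).
Proof. by move=> u v; rewrite /Padj orbC. Qed.

Lemma Padj_irr alpha : irreflexive (Padj alpha).
Proof. by move=> u; rewrite /Padj; case: eqP => //=; lia. Qed.

Definition grid_adj (alpha : word4) (n m : nat) : rel ('I_n.+1 * 'I_m.+1) :=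
  fun u v => Padj alpha (val u.1, val u.2) (val v.1, val v.2).
Lemma grid_sym alpha n m : symmetric (@grid_adj alpha n m).
Proof. by move=> u v; apply: Padj_sym. Qed.
Lemma grid_irr alpha n m : irreflexive (@grid_adj alpha n m).
Proof. by move=> u; apply: Padj_irr. Qed.
Definition grid alpha n m : fgraph :=
  FGraph (@grid_sym alpha n m) (@grid_irr alpha n m).

Lemma grid_Gclass alpha n m : Gclass alpha (grid alpha n m).
Proof.
exists (fun u => (val u.1, val u.2)); split=> // -[a b] [c d] /= [e1 e2].
by congr (_, _); apply: val_inj.
Qed.

Lemma Gclass_hereditary alpha : hereditary (Gclass alpha).
Proof.
move=> G H [f [fi fa]] [g [gi ga]]; exists (f \o g); split.
  exact: inj_comp.
by move=> x y; rewrite /= fa ga.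
Qed.

Lemma Gclass_sub_grid alpha G : Gclass alpha G ->
  exists n m, 0 < m /\ induced_in (@adj (grid alpha n m)) G.
Proof.
move=> [f [fi fa]].
(* The extra column makes [m] positive, as [window_cut] requires. *)
pose n := \max_x (f x).1; pose m := (\max_x (f x).2).+1.
have hn x : (f x).1 < n.+1 by rewrite ltnS /n; exact: (@leq_bigmax _ (fun x => (f x).1) x).
have hm x : (f x).2 < m.+1.
  by rewrite ltnS leqW // /m; exact: (@leq_bigmax _ (fun x => (f x).2) x).
exists n, m; split=> //; exists (fun x => (Ordinal (hn x), Ordinal (hm x))); split.
  by move=> x y [e1 e2]; apply: fi; case: (f x) (f y) e1 e2 => [a b] [c d] /= -> ->.
by move=> x y; rewrite -fa /= /grid_adj /=; case: (f x); case: (f y).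
Qed.

(** Descend into an argument of a union as long as one has more than [q] vertices; the union where
    this stops has at most [2q]. There [l] is the current label. Equality of the final labels is
    carried along because later joins act through it. *)
Lemma balanced_subset k (t : cw_expr k) q : 0 < q -> q < #|cw_eval t| ->
  exists (U : {set cw_eval t}) (l : cw_eval t -> 'I_k),
    q < #|U| <= q.*2 /\
    forall x y, x \in U -> y \in U -> l x = l y ->
      label x = label y /\ forall z, z \notin U -> adj x z = adj y z.
Proof.
move=> q0; elim: t => [a|t1 IH1 t2 IH2|a b ab t IH|a b t IH].
- by rewrite card_unit; lia.
- rewrite card_sum => h.
  have [h1|h1] := ltnP q #|cw_eval t1|.
    have [U [l [Uq UP]]] := IH1 h1.
    exists [set inl x | x in U], (fun u => match u with inl x => l x | inr y => label y end).
    split; first by rewrite card_imset // => x y [].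
    move=> _ _ /imsetP[x xU ->] /imsetP[y yU ->] /(UP _ _ xU yU) [e h']; split=> //.
    move=> [z|z] //= zU; apply: h'; apply: contra zU => zU; exact: imset_f.
  have [h2|h2] := ltnP q #|cw_eval t2|.
    have [U [l [Uq UP]]] := IH2 h2.
    exists [set inr x | x in U], (fun u => match u with inl x => label x | inr y => l y end).
    split; first by rewrite card_imset // => x y [].
    move=> _ _ /imsetP[x xU ->] /imsetP[y yU ->] /(UP _ _ xU yU) [e h']; split=> //.
    move=> [z|z] //= zU; apply: h'; apply: contra zU => zU; exact: imset_f.
  exists setT, (@label _ (cw_eval (CwUnion t1 t2))); split.
    rewrite cardsT card_sum h /= -addnn; exact: leq_add.
  by move=> x y _ _ e; split=> // z; rewrite in_setT.
- case/IH=> U [l [Uq UP]]; exists U, l; split=> // x y xU yU /(UP _ _ xU yU) [e h'].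
  by split=> // z zU; rewrite /= /join_adj e h'.
- case/IH=> U [l [Uq UP]]; exists U, l; split=> // x y xU yU /(UP _ _ xU yU) [e h'].
  by split=> //=; rewrite e.
Qed.

Lemma cliquewidth_balanced (G : fgraph) q : 0 < q -> q < #|G| ->
  exists (U : {set G}) (l : G -> 'I_(cliquewidth G)),
    q < #|U| <= q.*2 /\
    forall x y, x \in U -> y \in U -> l x = l y ->
      forall z, z \notin U -> adj x z = adj y z.
Proof.
move=> q0 qG.
have [h|[t [f [[g gf fg] fa]]]] := cliquewidth_buildable G; first lia.
have fi := can_inj gf; have gi := can_inj fg.
have cG : #|cw_eval t| = #|G|.
  by apply/eqP; rewrite eqn_leq (leq_card f fi) (leq_card g gi).
have [|U [l [Uq UP]]] := @balanced_subset _ t q q0; first by rewrite cG.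
exists [set f x | x in U], (fun v => l (g v)); split; first by rewrite card_imset.
move=> _ _ /imsetP[x xU ->] /imsetP[y yU ->]; rewrite !gf => e z zU.
have [_ h] := UP _ _ xU yU e.
rewrite -(fg z) !fa; apply: h; apply: contra zU => zU.
by rewrite -(fg z); apply: imset_f.
Qed.

Lemma letter_recurs (alpha : word4) j : almost_periodic alpha ->
  exists L, forall q, exists b, q <= b < q + L /\ alpha b = alpha j.
Proof.
move=> /(_ [:: alpha j]) [|L LP].
  by exists j; rewrite /mkseq /= addn0.
exists L => q.
have : infix [:: alpha j] (mkseq (fun n => alpha (q + n)) L).
  by apply: LP; [exists q; rewrite size_mkseq | rewrite size_mkseq].
move/mem_infix => /(_ (alpha j)); rewrite mem_head => /(_ isT).
case/mapP=> i; rewrite mem_iota => ib ->; exists (q + i); split=> //; lia.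
Qed.

Lemma column_link_total (a : 'I_4) i j : a != ord0 -> i != j ->
  ~~ column_link a i j -> column_link a j i.
Proof.
case: a => [[|[|[|[|]]]] ? //=] _; rewrite /column_link /=; lia.
Qed.

(** The rows [i] and [j] of the next column tell the two vertices apart. This forces distinct labels
    where rows leave [U]. *)
Lemma column_link_distinct (a : 'I_4) i j :
  column_link a i i = column_link a j i -> column_link a i j = column_link a j j ->
  i = j.
Proof.
case: a => [[|[|[|[|]]]] ? //=]; rewrite /column_link /=; lia.
Qed.

Lemma column_link_distinct_r (a : 'I_4) i j :
  column_link a i i = column_link a i j -> column_link a j i = column_link a j j ->
  i = j.
Proof.
case: a => [[|[|[|[|]]]] ? //=]; rewrite /column_link /=; lia.
Qed.

Lemma Padj_succ alpha i j c : Padj alpha (i, c) (j, c.+1) = column_link (alpha c) i j.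
Proof. by rewrite /Padj /= eqxx; case: eqP => [|_]; [lia|rewrite orbF]. Qed.

(** * Rows of a grid against a set with few outside neighbourhoods *)

Section Rows.
Variables (alpha : word4) (n m c : nat).
Variables (U : {set grid alpha n m}) (l : grid alpha n m -> 'I_c).
Hypothesis UP : forall x y, x \in U -> y \in U -> l x = l y ->
  forall z, z \notin U -> adj x z = adj y z.

Let inU (r : 'I_n.+1) (b : nat) := (r, inord b : 'I_m.+1) \in U.

Definition broken : {set 'I_n.+1} :=
  [set r | [exists b : 'I_m, inU r b != inU r b.+1]].

(** A broken row is encoded by a place where it breaks, the side of the left vertex there, and the
    label of whichever of the two vertices is in [U]. Two rows with the same code would have
    vertices in [U] that agree on both vertices outside, against [column_link_distinct] or its
    mirror image. *)
Lemma broken_card : #|broken| <= m * 2 * c.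
Proof.
have [->|[r0]] := set_0Vmem broken; first by rewrite cards0.
rewrite inE => /existsP[b0 _].
pose fb r : 'I_m := odflt b0 [pick b : 'I_m | inU r b != inU r b.+1].
have fbP r : r \in broken -> inU r (fb r) != inU r (fb r).+1.
  rewrite inE /fb => h; case: pickP => [//|h'].
  by case/existsP: h => b; rewrite h'.
pose g r := (fb r, inU r (fb r), if inU r (fb r) then l (r, inord (fb r)) else l (r, inord (fb r).+1)).
have <- : #|{: 'I_m * bool * 'I_c}| = m * 2 * c by rewrite !card_prod card_bool !card_ord.
suff gi : {in broken &, injective g}.
  by rewrite -(card_in_imset gi); apply: max_card.
move=> r1 r2 /fbP h1 /fbP h2 [e1]; move: h1 h2; rewrite -{}e1.
move: (fb r1) => b h1 h2 e2; move: h2; rewrite -e2 => h2.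
have bm : b < m.+1 by apply: ltnW; rewrite ltnS.
have adjE (r r' : 'I_n.+1) :
    @adj (grid alpha n m) (r, inord b) (r', inord b.+1) = column_link (alpha b) r r'.
  by rewrite /= /grid_adj /= (inordK bm) (@inordK m b.+1) ?ltnS // Padj_succ.
case Eu: (inU r1 b) e2 h1 h2 => e2 h1 h2 el.
- have := UP Eu (esym e2) el; apply: contraPP => ne h.
  have n1 : (r1, inord b.+1) \notin U by move: h1; rewrite /inU; case: (_ \in U).
  have n2 : (r2, inord b.+1) \notin U by move: h2; rewrite /inU; case: (_ \in U).
  apply: ne; apply: val_inj; apply: (@column_link_distinct (alpha b)).
    by rewrite -!adjE h.
  by rewrite -!adjE h.
- have u1 : (r1, inord b.+1) \in U by move: h1; rewrite /inU; case: (_ \in U).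
  have u2 : (r2, inord b.+1) \in U by move: h2; rewrite /inU; case: (_ \in U).
  have h := UP u1 u2 el.
  have n1 : (r1, inord b) \notin U by rewrite -/(inU r1 b) Eu.
  have n2 : (r2, inord b) \notin U by rewrite -/(inU r2 b) -e2.
  apply: val_inj; apply: (@column_link_distinct_r (alpha b)).
    by rewrite -!adjE adj_sym h // adj_sym.
  by rewrite -!adjE adj_sym h // adj_sym.
Qed.

Lemma unbroken_const r (b b' : 'I_m.+1) : r \notin broken ->
  ((r, b) \in U) = ((r, b') \in U).
Proof.
rewrite inE negb_exists => /forallP h.
suff H k : k < m.+1 -> inU r k = inU r 0.
  by rewrite -(inord_val b) -(inord_val b') -!/(inU _ _) H // H.
elim: k => [//|k IH] km; rewrite -IH 1?ltnW //.
by have := h (Ordinal (km : k < m)); rewrite negbK => /eqP.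
Qed.

(** If no row lies inside [U], only broken rows meet [U], and these have too few vertices. *)
Lemma row_in : m * 2 * c * m.+1 < #|U| -> exists r, forall b, (r, b) \in U.
Proof.
move=> Uc; apply: contrapT => h.
have sub : U \subset setX broken [set: 'I_m.+1].
  apply/subsetP => -[r b] rU; rewrite in_setX in_setT andbT.
  apply: contrapT => /negP rb; apply: h; exists r => b'.
  by rewrite (unbroken_const b' b rb).
move: Uc; rewrite ltnNge => /negP; apply.
apply: leq_trans (subset_leq_card sub) _; rewrite cardsX cardsT card_ord.
exact: leq_mul broken_card (leqnn _).
Qed.

Lemma row_out : m * 2 * c * m.+1 < #|~: U| -> exists r, forall b, (r, b) \notin U.
Proof.
move=> Uc; apply: contrapT => h.
have sub : ~: U \subset setX broken [set: 'I_m.+1].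
  apply/subsetP => -[r b]; rewrite in_setC => rU; rewrite in_setX in_setT andbT.
  apply: contrapT => /negP rb; apply: h; exists r => b'.
  by rewrite (unbroken_const b' b rb).
move: Uc; rewrite ltnNge => /negP; apply.
apply: leq_trans (subset_leq_card sub) _; rewrite cardsX cardsT card_ord.
exact: leq_mul broken_card (leqnn _).
Qed.

(* Across the cut, each of the links [bs u] carries an edge between the rows
   [i] and [j], and links three apart do not see each other. *)
Lemma rows_many_labels i j k (bs : 'I_k -> nat) :
  (forall b, (i, b) \in U) -> (forall b, (j, b) \notin U) ->
  (forall u, bs u < m) -> (forall u, alpha (bs u) != ord0) ->
  (forall u v : 'I_k, u < v -> bs u + 3 <= bs v) -> k <= c.
Proof.
move=> iU jU bm bn bs3.
have ij : (i : nat) != j.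
  by apply: contraTneq (iU ord0) => /val_inj->; apply: jU.
(* [e u] tells which direction of the link joins the two rows; the endpoints [x u] and [y u] are
   placed in the columns accordingly. *)
pose e u := column_link (alpha (bs u)) i j.
pose x u : grid alpha n m := (i, inord (if e u then bs u else (bs u).+1)).
pose y u : grid alpha n m := (j, inord (if e u then (bs u).+1 else bs u)).
have xy u : adj (x u) (y u).
  rewrite /= /grid_adj /= !inordK; try by have := bm u; case: (e u); lia.
  case Ee: (e u); first by rewrite Padj_succ.
  rewrite Padj_sym Padj_succ; apply: column_link_total => //.
  by rewrite -/(e u) Ee.
have nxy u v : u != v -> ~~ adj (x u) (y v).
  move=> uv; have : u < v \/ v < u by have: (u : nat) != v by []; lia.
  move=> H; have {H} : bs u + 3 <= bs v \/ bs v + 3 <= bs u.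
    by case: H => /bs3; lia.
  rewrite /= /grid_adj /= !inordK; try by have := bm u; have := bm v; case: (e _); lia.
  by rewrite /Padj /=; case: (e u); case: (e v); lia.
have li : injective (l \o x).
  move=> u v /= el; apply: contrapT => /eqP uv.
  have := UP (iU _) (iU _) el (jU (y u).2).
  by rewrite -/(x u) -/(x v) -/(y u) xy; have := nxy v u; rewrite eq_sym => /(_ uv) /negbTE ->.
by have := leq_card _ li; rewrite !card_ord.
Qed.
End Rows.

Lemma Gclass_unbounded alpha : almost_periodic alpha ->
  (exists j, alpha j != ord0) -> ~ bounded_cw (Gclass alpha).
Proof.
move=> ap [j j0] [k kP].
have [L LP] := letter_recurs j ap.
(* One occurrence is taken from each of [k + 1] stretches of length [L], separated by gaps of 3. *)
have /choice[bs bsP] := fun u : 'I_k.+1 => LP (u * (L + 3)).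
pose m := k.+1 * (L + 3).
(* [q] exceeds the bound of [row_in], and [n = 3q] leaves more than [q] vertices outside a set of at
   most [2q]. *)
pose q := (m * 2 * k * m.+1).+1; pose n := 3 * q.
have cE : #|grid alpha n m| = n.+1 * m.+1 by rewrite card_prod !card_ord.
have ck := kP _ (grid_Gclass alpha n m).
have [||U [l [/andP[Uq Uq2] UP]]] := @cliquewidth_balanced (grid alpha n m) q.
- by [].
- rewrite cE /n; nia.
have mk : m * 2 * cliquewidth (grid alpha n m) * m.+1 < q.
  by rewrite /q ltnS leq_mul2r leq_mul2l ck !orbT.
have [i iU] := row_in UP (ltn_trans mk Uq).
have [|i' iU'] := row_out UP.
  apply: ltn_trans mk _; have h1 : n.+1 <= n.+1 * m.+1 by rewrite leq_pmulr.
  have h2 := cardsC U; rewrite cE in h2; move: h1 h2 Uq2; rewrite {1}/n.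
  by move: #|U| #|~: U| (n.+1 * m.+1) (q) => u v w q'; clear; lia.
have bm u : bs u < m.
  have [/andP[_ h] _] := bsP u; apply: leq_trans h _; rewrite /m.
  by have := ltn_ord u; nia.
suff : k.+1 <= k by rewrite ltnn.
apply: leq_trans ck.
apply: (rows_many_labels UP iU iU' bm) => [u|u v uv].
  by have [_ ->] := bsP u.
by have [/andP[_ h] _] := bsP u; have [/andP[h' _] _] := bsP v; nia.
Qed.

(** * Cutting a window *)

(** Equivalent to [column_link a i k = column_link a i i]: the two rows are linked as if they were
    equal. *)
Definition letter_step (a : 'I_4) (i k : nat) : bool :=
  match val a with
  | 0 | 1 => i == k
  | 2 => i <= k
  | _ => k <= i
  end.

Definition thread m (a : word4) (S : nat -> pred nat) (T : nat -> nat) : Prop :=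
  (forall b, b <= m -> S b (T b)) /\
  (forall b, b < m -> letter_step (a b) (T b) (T b.+1)).

(* The common value of the links leaving a cut at a letter [a], where [s] tells
   whether the left endpoint lies in the first part. *)
Definition cut_link (a : 'I_4) (s : bool) : bool :=
  match val a with
  | 0 => false
  | 1 => true
  | _ => ~~ s
  end.

Definition clean_cut m (a : word4) (S A : nat -> pred nat) : Prop :=
  forall b, b < m -> forall r r', S b r -> S b.+1 r' ->
    A b r != A b.+1 r' -> column_link (a b) r r' = cut_link (a b) (A b r).

Definition consp (P : pred nat) (A : nat -> pred nat) (b : nat) : pred nat :=
  if b is b'.+1 then A b' else P.

Lemma clean_cut_cons m (a : word4) (S : nat -> pred nat) P A :
  clean_cut m (fun b => a b.+1) (fun b => S b.+1) A ->
  (forall r r', S 0 r -> S 1 r' -> P r != A 0 r' ->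
     column_link (a 0) r r' = cut_link (a 0) (P r)) ->
  clean_cut m.+1 a S (consp P A).
Proof. by move=> cA h [|b] bm r r'; [apply: h | apply: cA]. Qed.

Lemma thread_cons m (a : word4) (S : nat -> pred nat) T r :
  thread m (fun b => a b.+1) (fun b => S b.+1) T ->
  S 0 r -> letter_step (a 0) r (T 0) ->
  thread m.+1 a S (fun b => if b is b'.+1 then T b' else r).
Proof. by move=> [TS Tl] Sr Tr; split=> [[|b]|[|b]] //; [apply: TS|apply: Tl]. Qed.

Definition ordered_sets (X Y : pred nat) : Prop :=
  (forall x y, X x -> Y y -> y < x) \/ (forall x y, X x -> Y y -> x < y).

(* [X] and [Y] record the rows of the first column whose side is prescribed by
   the columns before it: [X] goes to the first part, and [Y] to the second one.
   When the letters change direction this may be impossible for [Y]; then all of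
   [Y] joins the first part, and so can everything to its left. *)
Lemma threadless_cut m B : forall (a : word4) (S : nat -> pred nat) (X Y : pred nat),
  (forall b r, S b r -> r < B) -> ordered_sets X Y ->
  ~ (exists T, thread m a S T /\ X (T 0)) ->
  exists A, [/\ clean_cut m a S A, forall r, S m r -> ~~ A m r,
    forall r, S 0 r -> X r -> A 0 r &
    (forall r, S 0 r -> Y r -> ~~ A 0 r) \/ (forall r, S 0 r -> Y r -> A 0 r)].
Proof.
elim: m => [|m IH] a S X Y SB XY nT.
  exists (fun _ _ => false); split=> //; last by left.
  move=> r Sr Xr; case: nT; exists (fun _ => r); split=> //; split=> // b.
  by rewrite leqn0 => /eqP ->.
pose a' b := a b.+1; pose S' b := S b.+1.
have SB' b r : S' b r -> r < B by apply: SB.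
(* A letter 2 or 3: the cut is a threshold at the extreme row [rho] of [X]. *)
have threshold (U : pred nat) rho : S 0 rho -> X rho ->
    (forall r, letter_step (a 0) rho r = U r) ->
    (forall r, U r = (rho <= r)) \/ (forall r, U r = (r <= rho)) ->
    (forall r, S 0 r -> X r -> U r) ->
    (forall r r', U r != U r' -> column_link (a 0) r r' = ~~ U r) ->
    cut_link (a 0) =1 negb ->
    exists A, [/\ clean_cut m.+1 a S A, forall r, S m.+1 r -> ~~ A m.+1 r,
      forall r, S 0 r -> X r -> A 0 r &
      (forall r, S 0 r -> Y r -> ~~ A 0 r) \/ (forall r, S 0 r -> Y r -> A 0 r)].
  move=> Srho Xrho stepU UE XU linkU cl.
  have oU : ordered_sets U (predC U).
    by case: UE => UE; [left|right] => x y /=; rewrite !UE; lia.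
  have [|A [cA Am AX AY]] := IH a' S' U (predC U) SB' oU.
    (* [U] consists of the rows reached from [rho] in one step, so a thread starting in [U] extends
       back to [rho]. *)
    move=> [T [TT UT]]; apply: nT.
    by eexists; split; [apply: (thread_cons TT Srho); rewrite stepU | ].
  (* If the complement of [U] joins the first part as well, the whole next column is there, and the
     current column can follow without any crossing pair. *)
  case: AY => AY; last first.
    exists (consp predT A); split=> //; last by right.
    apply: clean_cut_cons => // r r' Sr Sr'.
    have [Ur|Ur] := boolP (U r'); first by rewrite AX.
    by rewrite AY.
  have AE r : S' 0 r -> A 0 r = U r.
    by move=> Sr; have [/AX->|/AY/negbTE->] := boolP (U r).
  exists (consp U A); split=> //=.
    by apply: clean_cut_cons => // r r' Sr Sr'; rewrite AE // => /linkU->; rewrite cl.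
  (* [Y] lies entirely on one side of [rho], hence entirely inside or entirely outside the
     threshold. *)
  by have [yx|xy] := XY; have [UE'|UE'] := UE; [left|right|right|left] => r _ Yr;
    rewrite UE'; have := Yr; [move/(yx _ _ Xrho)|move/(yx _ _ Xrho)|
    move/(xy _ _ Xrho)|move/(xy _ _ Xrho)]; lia.
(* A letter 0 or 1: the rows run straight through. *)
have straight : (forall i k, letter_step (a 0) i k = (i == k)) ->
    (forall r r', r != r' -> forall s, column_link (a 0) r r' = cut_link (a 0) s) ->
    exists A, [/\ clean_cut m.+1 a S A, forall r, S m.+1 r -> ~~ A m.+1 r,
      forall r, S 0 r -> X r -> A 0 r &
      (forall r, S 0 r -> Y r -> ~~ A 0 r) \/ (forall r, S 0 r -> Y r -> A 0 r)].
  move=> stepE linkE.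
  have [||A [cA Am AX AY]] := IH a' S' [pred r | X r && S 0 r] [pred r | Y r && S 0 r] SB'.
  - by case: XY => h; [left|right] => x y /andP[Xx _] /andP[Yy _]; apply: h.
  - move=> [T [TT /andP[XT ST]]]; apply: nT.
    by eexists; split; [apply: (thread_cons TT ST); rewrite stepE | ].
  (* A row present in the next column copies its side from there, so crossing pairs lie in distinct
     rows. A row absent there is free: it follows [X], or joins the first part if [y] is set. *)
  pose P y := [pred r | if S 1 r then A 0 r else X r || y].
  have PX y r : S 0 r -> X r -> P y r.
    by move=> Sr Xr /=; case: ifP => [Sr'|_]; [apply: AX; rewrite //= Xr | rewrite Xr].
  have cP y : clean_cut m.+1 a S (consp (P y) A).
    apply: clean_cut_cons => // r r' Sr Sr' ne; apply: linkE.
    by apply: contraNneq ne => rr'; rewrite /= {1}rr' Sr' rr'.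
  case: AY => AY; [exists (consp (P false) A) | exists (consp (P true) A)]; split=> //=.
  - exact: PX.
  - left=> r Sr Yr; case: ifP => [Sr'|_]; first by apply: AY; rewrite //= Yr.
    rewrite orbF; apply/negP => Xr.
    by case: XY => /(_ _ _ Xr Yr); rewrite ltnn.
  - exact: PX.
  - right=> r Sr Yr; case: ifP => [Sr'|_]; last by rewrite orbT.
    by apply: AY; rewrite //= Yr.
have [[r0 /andP[Sr0 Xr0]]|nX] := pselect (exists r, S 0 r && X r); last first.
  exists (fun _ _ => false); split=> //; last by left.
  by move=> r Sr Xr; case: nX; exists r; rewrite Sr.
have exX : exists r, S 0 r && X r by exists r0; rewrite Sr0.
have Xb r : S 0 r && X r -> r <= B by case/andP=> /SB /ltnW.
have a4 := ltn_ord (a 0); case Ea: (val (a 0)) => [|[|[|]]] //=.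
- by apply: straight => [i k|r r' /negbTE ne s]; rewrite /letter_step /column_link /cut_link Ea.
- by apply: straight => [i k|r r' ne s]; rewrite /letter_step /column_link /cut_link Ea.
- have [rho /andP[Sr Xr] rmin] := ex_minnP exX.
  apply: (threshold [pred r | rho <= r] rho) => //=.
  + by move=> r; rewrite /letter_step Ea.
  + by left.
  + by move=> r Sr' Xr'; apply: rmin; rewrite Sr'.
  + by move=> r r'; rewrite /column_link Ea; lia.
  + by move=> s; rewrite /cut_link Ea.
- have [rho /andP[Sr Xr] rmax] := ex_maxnP exX Xb.
  apply: (threshold [pred r | r <= rho] rho) => //=.
  + by move=> r; rewrite /letter_step Ea.
  + by right.
  + by move=> r Sr' Xr'; apply: rmax; rewrite Sr'.
  + by move=> r r'; rewrite /column_link Ea; lia.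
  + by move=> s; rewrite /cut_link Ea.
Qed.

(* Min-max for intervals, applied to the ranges of the threads; as usual, the
   next interval to pick is the one whose right end is smallest. *)
Lemma threads_disjoint_or_stabbed m (Thr : (nat -> nat) -> Prop) k : forall lo,
  (exists Ts : nat -> nat -> nat,
    (forall u, u < k -> Thr (Ts u) /\ forall b, b <= m -> lo <= Ts u b) /\
    (forall u v, u < v < k -> forall b b', b <= m -> b' <= m -> Ts u b < Ts v b'))
  \/ (exists P : seq nat, size P <= k /\
    forall T, Thr T -> (forall b, b <= m -> lo <= T b) ->
      exists p b b', [/\ p \in P, b <= m, b' <= m & T b <= p <= T b']).
Proof.
elim: k => [|k IH] lo; first by left; exists (fun _ _ => 0); split=> // u v; lia.
pose Q h := `[< exists T, Thr T /\ forall b, b <= m -> lo <= T b <= h >].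
have [[h0 Qh0]|nQ] := pselect (exists h, Q h); last first.
  right; exists [::]; split=> // T TT Tlo; case: nQ.
  exists (\max_(b < m.+1) T b); apply/asboolP; exists T; split=> // b bm.
  rewrite Tlo //=; exact: (@leq_bigmax _ (fun b : 'I_m.+1 => T b) (Ordinal (bm : b < m.+1))).
have exQ : exists h, Q h by exists h0.
have [h /asboolP[T0 [T0T T0b]] hmin] := ex_minnP exQ.
have [[Ts [Ts1 Ts2]]|[P [Pk PP]]] := IH h.+1.
  left; exists (fun u => if u is u'.+1 then Ts u' else T0); split.
    move=> [|u] uk; first by split=> // b /T0b/andP[].
    have [TT Tb] := Ts1 u uk; split=> // b bm.
    have /andP[] := T0b b bm; have := Tb b bm; lia.
  move=> [|u] [|v] //= uv b b' bm bm'; last by apply: Ts2.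
  have [_ Tb] := Ts1 v uv; have /andP[_] := T0b b bm; have := Tb b' bm'; lia.
right; exists (h :: P); split=> // T TT Tlo.
have [b' [bm' hb']] : exists b', b' <= m /\ h <= T b'.
  apply: contrapT => nb.
  have Th b : b <= m -> T b < h.
    by move=> bm; rewrite ltnNge; apply/negP => hT; apply: nb; exists b.
  (* A thread staying below [h] would fit under [h.-1], against minimality; the bound at column 0
     shows that [h] is positive. *)
  have := hmin h.-1; have := Th 0 isT => h1; have {h1}-> : (h <= h.-1) = false by lia.
  move=> /(_ _) F; suff : false by [].
  apply: F; apply/asboolP; exists T; split=> // b bm.
  by rewrite Tlo //=; have := Th b bm; lia.
have [[b [bm hb]]|nb] := pselect (exists b, b <= m /\ T b <= h).
  by exists h, b, b'; rewrite mem_head hb hb'.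
have [|p [c [c' [pP cm cm' pT]]]] := PP T TT.
  by move=> b bm; rewrite ltnNge; apply/negP => hT; apply: nb; exists b.
by exists p, c, c'; split=> //; rewrite in_cons pP orbT.
Qed.

(* Monotone, constant on the gaps between the points of [P], and separating each
   point from all other rows. *)
Definition gap_pos (P : seq nat) (r : nat) : nat :=
  count (fun p => p < r) P + count (fun p => p <= r) P.

Lemma gap_pos_le (P : seq nat) r : gap_pos P r <= (size P).*2.
Proof. by rewrite /gap_pos -addnn leq_add ?count_size. Qed.

Lemma gap_pos_mono (P : seq nat) r r' : r <= r' -> gap_pos P r <= gap_pos P r'.
Proof.
move=> rr'; apply: leq_add; apply: sub_count => p /= h; lia.
Qed.

(** The second count jumps on reaching [p] and the first on leaving it. *)
Lemma gap_pos_point (P : seq nat) p r : p \in P -> gap_pos P r = gap_pos P p -> r = p.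
Proof.
move=> pP; rewrite /gap_pos; elim: P pP => [//|x P IH].
have c1 (P' : seq nat) i j : i <= j -> count (fun p => p < i) P' <= count (fun p => p < j) P'.
  by move=> ij; apply: sub_count => y /=; lia.
have c2 (P' : seq nat) i j : i <= j -> count (fun p => p <= i) P' <= count (fun p => p <= j) P'.
  by move=> ij; apply: sub_count => y /=; lia.
rewrite in_cons => /orP[/eqP <-|pP] /= e.
  have [rp|rp] := leqP r p.
    by have := c1 P _ _ rp; have := c2 P _ _ rp; lia.
  by have := c1 P _ _ (ltnW rp); have := c2 P _ _ (ltnW rp); lia.
apply: IH => //; have [rp|rp] := leqP r p.
  by have := c1 P _ _ rp; have := c2 P _ _ rp; lia.
by have := c1 P _ _ (ltnW rp); have := c2 P _ _ (ltnW rp); lia.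
Qed.

Definition grid_threads m (a : word4) (S : nat -> pred nat) k (Ts : nat -> nat -> nat) :=
  (forall u, u < k -> thread m a S (Ts u)) /\
  (forall u v, u < v < k -> forall b b', b <= m -> b' <= m -> Ts u b < Ts v b').

(** Each class of [gap_pos] is cut separately. A class without a point of [P] carries no thread,
    since a point stabbing it would lie in the class by monotonicity; [threadless_cut] applies, with
    the whole first column prescribed. A class with a point of [P] is a single row and is simply cut
    before the last column. *)
Lemma window_cut m B (a : word4) (S : nat -> pred nat) k :
  0 < m -> (forall b r, S b r -> r < B) ->
  ~ (exists Ts, grid_threads m a S k Ts) ->
  exists (A : nat -> pred nat) (pos : nat -> nat),
  [/\ forall r, pos r <= k.*2, {homo pos : r r' / r <= r'},
      forall r, S 0 r -> A 0 r, forall r, S m r -> ~~ A m r &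
      forall b, b < m -> forall r r', S b r -> S b.+1 r' -> pos r = pos r' ->
        A b r != A b.+1 r' ->
        (column_link (a b) r r' = cut_link (a b) (A b r)) \/
        (forall x, pos x = pos r -> x = r)].
Proof.
move=> m0 SB ng.
have [[Ts [Ts1 Ts2]]|[P [Pk PP]]] := @threads_disjoint_or_stabbed m (thread m a S) k 0.
  by case: ng; exists Ts; split=> // u /Ts1[].
pose Sg g b : pred nat := [pred r | S b r && (gap_pos P r == g)].
have /choice[A AP] : forall g, exists A : nat -> pred nat,
    [/\ forall r, Sg g 0 r -> A 0 r, forall r, Sg g m r -> ~~ A m r &
     clean_cut m a (Sg g) A \/ exists2 p, p \in P & gap_pos P p = g].
  move=> g; have [[p pP pg]|np] := pselect (exists2 p, p \in P & gap_pos P p = g).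
    exists (fun b _ => b < m); split=> //; first by rewrite ltnn.
    by right; exists p.
  have [|||A [cA Am A0 _]] := @threadless_cut m B a (Sg g) predT pred0.
  - by move=> b r /andP[/SB].
  - by left.
  - move=> [T [[TS TL] _]].
    have [||p [b [b' [pP bm bm' /andP[pb pb']]]]] := PP T.
    + by split=> // b /TS /andP[].
    + by [].
    + apply: np; exists p => //; apply/eqP; rewrite eqn_leq.
      have /andP[_ /eqP <-] := TS b bm.
      have /andP[_ /eqP e'] := TS b' bm'; have /andP[_ /eqP e] := TS b bm.
      by rewrite (gap_pos_mono P pb) e -e' (gap_pos_mono P pb').
  by exists A; split=> //; [move=> r Sr; apply: A0 | left].
exists (fun b r => A (gap_pos P r) b r), (gap_pos P); split.
- by move=> r; apply: leq_trans (gap_pos_le _ _) _; rewrite leq_double.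
- by move=> r r'; apply: gap_pos_mono.
- by move=> r Sr; have [h _ _] := AP (gap_pos P r); apply: h; rewrite /Sg /= Sr eqxx.
- by move=> r Sr; have [_ h _] := AP (gap_pos P r); apply: h; rewrite /Sg /= Sr eqxx.
move=> b bm r r' Sr Sr' e ne; have [_ _] := AP (gap_pos P r).
case=> [cA|[p pP pr]]; [left|right].
  by apply: cA => //; rewrite /Sg /= ?Sr ?Sr' -?e ?eqxx //; move: ne; rewrite -e.
by move=> x xr; rewrite (gap_pos_point pP (esym pr)); apply: (gap_pos_point pP); rewrite xr.
Qed.

(** * Sweeping the pieces *)

Lemma column_link_cmp (a : 'I_4) r1 r2 r : r1 != r -> r2 != r -> (r1 < r) = (r2 < r) ->
  column_link a r1 r = column_link a r2 r /\ column_link a r r1 = column_link a r r2.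
Proof. by rewrite /column_link; case: (val a) => [|[|[|]]]; lia. Qed.

Lemma Padj_lt_row alpha r1 r2 r c c' : r1 < r -> r2 < r ->
  Padj alpha (r1, c) (r, c') = Padj alpha (r2, c) (r, c').
Proof.
move=> h1 h2; rewrite /Padj /=.
have e a : column_link a r1 r = column_link a r2 r /\ column_link a r r1 = column_link a r r2.
  by apply: column_link_cmp; lia.
by rewrite (e _).1 (e _).2.
Qed.

Section Chain.
Variables (alpha : word4) (G : fgraph) (f : G -> nat * nat) (T : finType) (C : nat).
Variables (A : nat -> pred G) (cl : nat -> G -> T) (lo : nat -> nat).
Hypothesis fE : embedding (@adj G) (Padj alpha) f.
Hypothesis A_mono : forall i x, A i x -> A i.+1 x.
Hypothesis A_cover : forall x, exists i, A i x.
Hypothesis A_cols : forall i x, A i x -> (forall j, j < i -> ~~ A j x) ->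
  lo i <= (f x).2 <= lo i + C.
Hypothesis A_cut : forall i x y z, A i x -> A i y -> ~~ A i z -> cl i x = cl i y ->
  adj x z = adj y z.

Definition piece x : nat := ex_minn (A_cover x).

Lemma pieceP i x : A i x = (piece x <= i).
Proof.
rewrite /piece; case: ex_minnP => j Aj jmin; apply/idP/idP => [/jmin //|].
by elim: i => [|i IH]; [rewrite leqn0 => /eqP <-|rewrite leq_eqVlt => /orP[/eqP <- //|/IH/A_mono]].
Qed.

Definition sweep_le : rel G := fun x y =>
  (piece x < piece y) || (piece x == piece y) &&
  (((f x).1 < (f y).1) || ((f x).1 == (f y).1) && ((f x).2 <= (f y).2)).

Lemma sweep_total : total sweep_le.
Proof. by move=> x y; rewrite /sweep_le; lia. Qed.

Lemma sweep_trans : transitive sweep_le.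
Proof. by move=> y x z; rewrite /sweep_le; lia. Qed.

(** Let [z0] be the first vertex not yet swept. For earlier pieces the class at the preceding cut
    suffices. In the current piece the class at its own cut serves the later pieces, and column and
    row serve the rest of the piece: in the row of [z0] the column determines the vertex, and any
    lower row compares alike with all remaining rows. *)
Lemma chain_cliquewidth : cliquewidth G <= #|{: T + 'I_C.+1 * bool * T}|.+1.
Proof.
have [fi fa] := fE.
apply: (@layout_cliquewidth _ _ (sort sweep_le (enum G))).
- by rewrite sort_uniq enum_uniq.
- by move=> x; rewrite mem_sort mem_enum.
move=> s1 [|z0 s2] es; first by exists (fun x => inl (cl 0 x)).
exists (fun x => if piece x < piece z0 then inl (cl (piece z0).-1 x) else
  inr (inord ((f x).2 - lo (piece z0)), (f x).1 == (f z0).1, cl (piece z0) x)).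
have := sort_sorted sweep_total (enum G).
rewrite es (sorted_pairwise sweep_trans) pairwise_cat pairwise_cons.
case/and3P=> /allrelP s12 _ /andP[/allP s0 _] x y xs ys.
have hz z : z \in z0 :: s2 -> sweep_le z0 z.
  by rewrite in_cons => /orP[/eqP ->|/s0 //]; rewrite /sweep_le; lia.
have := s12 x z0 xs (mem_head _ _); have := s12 y z0 ys (mem_head _ _).
have [xz|zx] := ltnP (piece x) (piece z0); have [yz|zy] := ltnP (piece y) (piece z0) => // yz0 xz0.
  case=> e z /hz z0z; apply: (@A_cut (piece z0).-1) e; rewrite pieceP; move: z0z; rewrite /sweep_le; lia.
have px : piece x = piece z0 by move: xz0; rewrite /sweep_le; lia.
have py : piece y = piece z0 by move: yz0; rewrite /sweep_le; lia.
have col u : piece u = piece z0 -> lo (piece z0) <= (f u).2 <= lo (piece z0) + C.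
  by move=> pu; apply: A_cols => [|j]; rewrite pieceP pu // ltnNge.
case=> /(congr1 val) ec er ecl z /hz z0z; move: ec; have := col _ px; have := col _ py => cy cx.
rewrite /= !inordK; try lia; move=> ec0; have ec : (f x).2 = (f y).2 by lia.
have [zp|zp] := leqP (piece z) (piece z0); last first.
  by apply: A_cut ecl; rewrite pieceP ?px ?py // -ltnNge.
have [rx|rx] := eqVneq (f x).1 (f z0).1.
  suff -> : x = y by [].
  apply: fi; move: er; rewrite rx eqxx => /esym/eqP ry.
  by rewrite [f x]surjective_pairing [f y]surjective_pairing ec rx ry.
move: er; rewrite (negbTE rx) => /esym/negbT ry.
have [xl yl zl] : [/\ (f x).1 < (f z0).1, (f y).1 < (f z0).1 & (f z0).1 <= (f z).1].
  by move: xz0 yz0 z0z; rewrite /sweep_le; split; lia.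
rewrite -!fa [f x]surjective_pairing [f y]surjective_pairing [f z]surjective_pairing ec.
by apply: Padj_lt_row; lia.
Qed.

End Chain.

(** Distinct threads are strictly ordered as their indices are; within one thread [letter_step]
    gives the link of equal rows. *)
Lemma grid_threads_Padj m alpha S k Ts p u v b c :
  grid_threads m alpha S k Ts -> (forall b, b < m -> alpha (p + b) = alpha b) ->
  u < k -> v < k -> b <= m -> c <= m ->
  Padj alpha (Ts u b, p + b) (Ts v c, p + c) = Padj alpha (u, b) (v, c).
Proof.
move=> [TT TD] pa.
have link u' v' d : u' < k -> v' < k -> d < m ->
    column_link (alpha (p + d)) (Ts u' d) (Ts v' d.+1) = column_link (alpha d) u' v'.
  move=> uk vk dm; rewrite pa //.
  have [uv|vu|<-] := ltngtP u' v'.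
  - have h : Ts u' d < Ts v' d.+1 by apply: TD; rewrite ?uv //; lia.
    by rewrite /column_link; case: (val _) => [|[|[|]]]; lia.
  - have h : Ts v' d.+1 < Ts u' d by apply: TD; rewrite ?vu //; lia.
    by rewrite /column_link; case: (val _) => [|[|[|]]]; lia.
  - have := (TT _ uk).2 _ dm; rewrite /column_link /letter_step.
    by case: (val _) => [|[|[|]]]; lia.
move=> uk vk bm cm; rewrite /Padj /=.
have e x y : (p + x == (p + y).+1) = (x == y.+1) by lia.
rewrite !e; congr (_ || _).
  by case: eqP => //= cb; rewrite cb link //; lia.
by case: eqP => //= cb; rewrite cb link //; lia.
Qed.

Lemma windows_exist (alpha : word4) m : almost_periodic alpha ->
  exists L, 0 < L /\ forall i, exists p, [/\ i * L <= p, p + m <= i.+1 * L &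
    forall b, b < m -> alpha (p + b) = alpha b].
Proof.
move=> /(_ (mkseq alpha m)) [|L LP].
  by exists 0; rewrite size_mkseq.
(* The successor makes the block length positive. *)
exists L.+1; split=> // i.
have /infixP[s1 [s2 e]] : infix (mkseq alpha m) (mkseq (fun n => alpha (i * L.+1 + n)) L.+1).
  by apply: LP; [exists (i * L.+1); rewrite size_mkseq | rewrite size_mkseq].
have := congr1 size e; rewrite !size_cat !size_mkseq => es.
exists (i * L.+1 + size s1); split; try lia.
move=> b bm; have := congr1 (fun s => nth ord0 s (size s1 + b)) e.
rewrite nth_mkseq; last lia.
rewrite nth_cat ltnNge leq_addr /= addKn nth_cat size_mkseq bm nth_mkseq // => <-.
by rewrite addnA.
Qed.

(** * Window cuts as a chain of vertex sets *)

Section Windows.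
Variables (alpha : word4) (n m L : nat) (p : nat -> nat).
Hypotheses (m0 : 0 < m) (L0 : 0 < L).
Hypothesis pP : forall i, [/\ i * L <= p i, p i + m <= i.+1 * L &
    forall b, b < m -> alpha (p i + b) = alpha b].
Variables (G : fgraph) (f : G -> nat * nat).
Hypothesis fE : embedding (@adj G) (Padj alpha) f.
Hypothesis Gn : ~ induced_in (@adj G) (grid alpha n m).

Let S i b : pred nat := [pred r | [exists x, f x == (r, p i + b)]].

(** Such threads would be the rows of an induced copy of the omitted grid. *)
Lemma no_grid_threads i : ~ exists Ts, grid_threads m alpha (S i) n.+1 Ts.
Proof.
move=> [Ts TsP]; apply: Gn; have [TT TD] := TsP; have [_ _ pa] := pP i.
have /choice[g gP] : forall u : grid alpha n m, exists x, f x = (Ts u.1 u.2, p i + u.2).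
  move=> [u b] /=; have := (TT u (ltn_ord u)).1 b (ltn_ord b).
  by case/existsP=> x /eqP; exists x.
have ga u v : adj (g u) (g v) = adj u v.
  rewrite -(fE.2) !gP.
  exact: (grid_threads_Padj TsP pa (ltn_ord u.1) (ltn_ord v.1) (ltn_ord u.2) (ltn_ord v.2)).
exists g; split=> // -[u b] [v c] /(congr1 f); rewrite !gP /= => -[eT eb].
have {eb} bc : b = c by apply: val_inj => /=; lia.
rewrite -{c}bc in eT *; congr (_, _); apply: val_inj => /=.
have h x y : x < y < n.+1 -> Ts x b < Ts y b by move=> xy; apply: TD => //; rewrite -ltnS.
have [uv|vu|//] := ltngtP u v.
  by have := h u v; rewrite uv ltn_ord eT ltnn => /(_ isT).
by have := h v u; rewrite vu ltn_ord eT ltnn => /(_ isT).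
Qed.

(** The chain set [A i] consists of everything left of window [i] and the first part of its cut; a
    vertex is classified by its column in the window and by [pos]. *)
Lemma windows_cliquewidth :
  cliquewidth G <= #|{: ('I_m.+2 * 'I_(n.+1).*2.+1) +
    'I_(2 * L).+1 * bool * ('I_m.+2 * 'I_(n.+1).*2.+1)}|.+1.
Proof.
have [fi fa] := fE.
pose B := (\max_x (f x).1).+1.
have SB i b r : S i b r -> r < B.
  case/existsP=> x /eqP e; rewrite ltnS.
  by have := @leq_bigmax _ (fun x => (f x).1) x; rewrite e.
have inS i x b : (f x).2 = p i + b -> S i b (f x).1.
  by move=> e; apply/existsP; exists x; rewrite -e -surjective_pairing.
have /choice[W WP] := fun i => window_cut m0 (SB i) (@no_grid_threads i).
have {WP} /choice[pos WP] := WP.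
pose A i : pred G := fun x => ((f x).2 < p i) ||
  ((f x).2 <= p i + m) && W i ((f x).2 - p i) (f x).1.
have A_first i x : (f x).2 = p i -> A i x.
  move=> e; rewrite /A e ltnn leq_addr subnn /=.
  by have [_ _ h _ _] := WP i; apply: h; apply: inS; rewrite addn0.
have A_hi i x : A i x -> (f x).2 < p i + m.
  have [_ _ _ h _] := WP i.
  case/orP=> [|/andP[]]; first by lia.
  rewrite leq_eqVlt => /orP[/eqP e|//]; rewrite e addKn => w.
  by have := h _ (inS _ _ _ e); rewrite w.
have A_win i x b : (f x).2 = p i + b -> b <= m -> A i x = W i b (f x).1.
  by move=> e bm; rewrite /A e addKn ltnNge leq_addr leq_add2l bm.
(* Truncated subtraction sends all columns left of the window to 0; the successor keeps the first
   column of the window apart from them. *)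
pose cl i x : 'I_m.+2 * 'I_(n.+1).*2.+1 := (inord ((f x).2.+1 - p i), inord (pos i (f x).1)).
(* A vertex new in [A i] is not left of window [i - 1] and lies before the end of window [i], hence
   in the blocks [i - 1] and [i] (only block 0 if [i = 0]), which span [2L] columns. *)
apply: (@chain_cliquewidth alpha G f _ _ A cl (fun i => i.-1 * L)) => //.
- move=> i x /A_hi h; have [_ h1 _] := pP i; have [h2 _ _] := pP i.+1.
  have : (f x).2 <= p i.+1 by lia.
  by rewrite leq_eqVlt => /orP[/eqP/A_first //|h3]; rewrite /A h3.
- move=> x; exists (f x).2.+1; rewrite /A; apply/orP; left.
  by have [h _ _] := pP (f x).2.+1; apply: leq_trans h; rewrite leq_pmulr.
- move=> [|i] x /A_hi h An; first by have [_ h1 _] := pP 0; lia.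
  have := An i (ltnSn _); rewrite negb_or -leqNgt => /andP[h1 _].
  have [_ h2 _] := pP i.+1; have [h3 _ _] := pP i; move: h h1 h2 h3 => /=; nia.
move=> i x y z Ax Ay Az [/(congr1 val) ec /(congr1 val) ep].
have [posk posm _ _ cut] := WP i; have [_ _ pa] := pP i.
have hx := A_hi _ _ Ax; have hy := A_hi _ _ Ay.
move: ec ep; rewrite /= !inordK; try by rewrite ?ltnS; have := posk (f x).1; have := posk (f y).1; lia.
move=> ec ep.
(* The first column of the window lies in [A i], so [z] is beyond it and sees nothing left of the
   window. *)
have zp : p i < (f z).2.
  rewrite ltn_neqAle; apply/andP; split; last by move: Az; rewrite negb_or -leqNgt => /andP[].
  by apply: contraNneq Az => /esym/A_first.
rewrite -!fa /Padj.
have [xp|xp] := ltnP (f x).2 (p i); first by lia.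
have {}ec : (f y).2 = (f x).2 by lia.
have [b eb] : exists b, (f x).2 = p i + b by exists ((f x).2 - p i); lia.
have bm : b < m by lia.
have Wx : W i b (f x).1 by rewrite -(A_win _ _ _ eb) // ltnW.
have Wy : W i b (f y).1 by rewrite -(A_win _ _ _ (etrans ec eb)) // ltnW.
have Sx := inS _ _ _ eb; have Sy := inS _ _ _ (etrans ec eb).
(* As [pos] is monotone, rows of equal position compare alike with a row of another position. *)
have cmp : pos i (f z).1 != pos i (f x).1 ->
    forall a, column_link a (f x).1 (f z).1 = column_link a (f y).1 (f z).1 /\
      column_link a (f z).1 (f x).1 = column_link a (f z).1 (f y).1.
  move=> ne a.
  have ltE u : pos i u = pos i (f x).1 -> (u != (f z).1) /\ (u < (f z).1) = (pos i (f x).1 < pos i (f z).1).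
    move=> eu; split; first by apply: contraNneq ne => <-; apply/eqP.
    apply/idP/idP => [uz|]; last by rewrite -eu !ltnNge; apply: contra => /posm.
    by rewrite ltn_neqAle eq_sym ne -eu posm // ltnW.
  have [h1 h2] := ltE _ erefl; have [h3 h4] := ltE _ (esym ep).
  by apply: column_link_cmp; rewrite ?h2 ?h4.
rewrite ec; congr (_ || _).
- case: eqP => //= ez; rewrite eb pa //.
  have ez' : (f z).2 = p i + b.+1 by lia.
  have Wz : ~~ W i b.+1 (f z).1 by rewrite -(A_win _ _ _ ez').
  have Sz := inS _ _ _ ez'.
  (* At equal positions either the link depends only on the letter and the side, or the position
     belongs to a single row, which then contains both [x] and [y]. *)
  have [epz|/cmp ne] := eqVneq (pos i (f z).1) (pos i (f x).1); last exact: (ne _).1.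
  have [|h|h] := cut b bm _ _ Sx Sz (esym epz).
  + by rewrite Wx (negbTE Wz).
  + have [||h'|h'] := cut b bm _ _ Sy Sz.
    * by rewrite -ep epz.
    * by rewrite Wy (negbTE Wz).
    * by rewrite h h' Wx Wy.
    * by rewrite (h' _ ep).
  + by rewrite (h _ (esym ep)).
- case: eqP => //= ez.
  have [d ed] : exists d, b = d.+1 by exists b.-1; lia.
  have ez' : (f z).2 = p i + d by lia.
  have dm : d < m by lia.
  have Wz : ~~ W i d (f z).1 by rewrite -(A_win _ _ _ ez') // ltnW.
  have Sz := inS _ _ _ ez'; rewrite ez' pa //.
  have [epz|/cmp ne] := eqVneq (pos i (f z).1) (pos i (f x).1); last exact: (ne _).2.
  rewrite ed in Wx Wy Sx Sy.
  have [|h|h] := cut d dm _ _ Sz Sx epz.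
  + by rewrite Wx (negbTE Wz).
  + have [||h'|h'] := cut d dm _ _ Sz Sy.
    * by rewrite -ep epz.
    * by rewrite Wy (negbTE Wz).
    * by rewrite h h'.
    * by rewrite (h' (f x).1) ?epz // (h' (f y).1) // -ep epz.
  + by rewrite (h (f x).1) ?epz // (h (f y).1) // -ep epz.
Qed.

End Windows.

Theorem theorem4p9 (alpha : word4) :
  almost_periodic alpha ->
  (exists j : nat, alpha j != ord0) ->
  minimal_unbounded_cw (Gclass alpha).
Proof.
move=> ap nz; split.
- exact: Gclass_hereditary.
- exact: Gclass_unbounded.
move=> D Dh [DC [G0 [CG0 DG0]]].
(* By heredity a member of [D] containing this grid would put the grid, and then [G0], into [D]. *)
have [n [m [m0 G0n]]] := Gclass_sub_grid CG0.
have [L [L0 /choice[p pP]]] := windows_exist m ap.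
eexists=> G DG; have [f fE] := DC _ DG.
apply: (windows_cliquewidth m0 L0 pP fE (n := n)) => Gg.
by apply: DG0; apply: (Dh _ _ _ G0n); apply: (Dh _ _ DG Gg).
Qed.
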